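(* Let $n\ge 1$ be an integer, let $\alpha_j=1$ for $j=1,\dots,n+1$, let $\lambda\in\mathbb{R}$, and let $\nu_1,\dots,\nu_n\in\mathbb{C}$ be such that $a_j\notin\{-1,-2,-3,\dots\}$ for $j=1,\dots,n$. Then for every $s\in\mathbb{C}$ with $\operatorname{Re}s>0$, $$\int_0^\infty e^{-sx}\,\mathcal{W}^{(\bar 1,\bar\nu)}(\lambda x)\,dx=\Big(\prod_{j=1}^n\Gamma(1+a_j)\Big)\frac1s\sum_{k=0}^\infty\frac{1}{\prod_{j=1}^n\Gamma(k+a_{j+1}+1)}\left(\frac{\lambda}{s}\right)^k=\Big(\prod_{j=1}^n\Gamma(1+a_j)\Big)\frac1s\,E^{(n)}_{(1,\dots,1),(a_2+1,\dots,a_{n+1}+1)}\!\left(\frac{\lambda}{s}\right).$$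
   Context: For parameters $\alpha_1,\dots,\alpha_{n+1}>0$, $\nu_1,\dots,\nu_n\in\mathbb{C}$, with the conventions $\alpha_0=\nu_0=0$, put for $j=1,\dots,n+1$ $$a_j=1+\sum_{m=1}^{j}(\nu_{m-1}-\alpha_m),\qquad b_j=1+\sum_{m=1}^{j}(\nu_{m-1}-\alpha_{m-1}),$$ so that $a_j=b_j-\alpha_j$. The multi-index special function is $$\mathcal{W}^{(\bar\alpha,\bar\nu)}(z)=\sum_{k=0}^\infty\left(\prod_{i=1}^k\prod_{j=1}^n\frac{\Gamma(\alpha_{n+1}i+a_j)}{\Gamma(\alpha_{n+1}i+b_j)}\right)\frac{z^k}{\Gamma(\alpha_{n+1}k+b_{n+1})},\qquad z\in\mathbb{C}.$$ $\mathcal{W}^{(\bar 1,\bar\nu)}$ denotes this function with all $\alpha_j=1$. The multi-index Mittag-Leffler function with all first indices equal to $1$ is $$E^{(n)}_{(1,\dots,1),(\mu_1,\dots,\mu_n)}(z)=\sum_{k=0}^\infty\frac{z^k}{\prod_{j=1}^n\Gamma(k+\mu_j)}.$$ Here $1/\Gamma$ is the entire reciprocal gamma function (equal to $0$ at the poles of $\Gamma$; products of reciprocals of gamma values are understood in this sense), and empty products equal $1$. *)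

(* Defs.v *)
From Stdlib Require Export Reals Factorial.
From Coquelicot Require Export Coquelicot.

Open Scope R_scope.
Open Scope C_scope.

Definition Cexp (z : C) : C :=
  (exp (fst z) * cos (snd z), exp (fst z) * sin (snd z))%R.

(* The product over i = 1, ..., n; it is 1 when n = 0. *)
Fixpoint Cprod (f : nat -> C) (n : nat) : C :=
  match n with
  | O => 1
  | S m => Cprod f m * f (S m)
  end.

(* Limits and sums of complex sequences, taken componentwise because Lim_seq
   and Series are real-valued. As with Series, the value carries no information
   when the sequence or series does not converge. *)
Definition CLim_seq (u : nat -> C) : C :=
  (real (Lim_seq (fun k => fst (u k))), real (Lim_seq (fun k => snd (u k)))).

Definition CSeries (u : nat -> C) : C :=
  (Series (fun k => fst (u k)), Series (fun k => snd (u k))).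

(* The entire function 1/Gamma, by the Euler-Gauss limit
     1/Gamma(z) = lim_m z (z+1) ... (z+m) / (m! m^z),
   which converges for every z in C and is 0 exactly at 0, -1, -2, ... *)
Definition rGamma_seq (z : C) (m : nat) : C :=
  z * Cprod (fun i => z + INR i) m / (INR (fact m) * Cexp (z * ln (INR m))).

Definition rGamma (z : C) : C := CLim_seq (rGamma_seq z).

(* Meaningful away from the poles 0, -1, -2, ..., where it takes the value / 0. *)
Definition Gamma (z : C) : C := / rGamma z.

(* The parameters are alpha_1, ..., alpha_{n+1} and nu_1, ..., nu_n. Whatever
   the value of the sequences at 0, the two functions below implement the
   convention alpha_0 = nu_0 = 0; values at larger indices are never used. *)
Definition alpha_ext (alpha : nat -> R) (m : nat) : R :=
  match m with O => 0%R | S _ => alpha m end.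

Definition nu_ext (nu : nat -> C) (m : nat) : C :=
  match m with O => 0 | S _ => nu m end.

Definition a_par (alpha : nat -> R) (nu : nat -> C) (j : nat) : C :=
  1 + sum_n_m (fun m => nu_ext nu (m - 1) - alpha_ext alpha m) 1 j.

Definition b_par (alpha : nat -> R) (nu : nat -> C) (j : nat) : C :=
  1 + sum_n_m (fun m => nu_ext nu (m - 1) - alpha_ext alpha (m - 1)) 1 j.

Definition W_term (n : nat) (alpha : nat -> R) (nu : nat -> C) (z : C)
    (k : nat) : C :=
  Cprod (fun i => Cprod (fun j =>
      Gamma (alpha (n + 1)%nat * INR i + a_par alpha nu j)
      * rGamma (alpha (n + 1)%nat * INR i + b_par alpha nu j)) n) k
  * (z ^ k * rGamma (alpha (n + 1)%nat * INR k + b_par alpha nu (n + 1))).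

Definition W (n : nat) (alpha : nat -> R) (nu : nat -> C) (z : C) : C :=
  CSeries (W_term n alpha nu z).

(* The multi-index Mittag-Leffler function with first indices (1, ..., 1) and
   second indices (mu_1, ..., mu_n). *)
Definition ML1_term (n : nat) (mu : nat -> C) (z : C) (k : nat) : C :=
  z ^ k * Cprod (fun j => rGamma (INR k + mu j)) n.

Definition ML1 (n : nat) (mu : nat -> C) (z : C) : C :=
  CSeries (ML1_term n mu z).

(* Main.v *)
Require Import Defs.
From Stdlib Require Import Lra Lia.

(** All [alpha_j] being 1, we have [b_j = a_j + 1] and [a_1 = 0], so the products of
gamma quotients in [W] telescope and the [k]-th term of [W z] is
[P * c_k * z ^ k / k!] with [P = prod Gamma (1 + a_j)] and
[c_k = prod_(1 <= j <= n) 1 / Gamma (k + a_(j+1) + 1)].  This rests on the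
convergence and non-vanishing of the Euler-Gauss limit, whose consecutive ratios
are [1 + O(1/m^2)], and on [1/Gamma (z) = z / Gamma (z + 1)], which also shows
that [c_k] decays faster than every geometric sequence.  The integral and the sum
are then not interchanged: the integrand has an explicit antiderivative that is
[exp (- s x)] times an exponential power series, and that vanishes at infinity. *)

(** * Limits and series of complex numbers *)

(** Balls of [C] are boxes of the product uniform structure. This is the bridge to [CLim_seq] and
    [CSeries], which are componentwise. *)
Lemma filterlim_C_iff {T : Type} {F : (T -> Prop) -> Prop} {FF : Filter F}
    (f : T -> C) (l : C) :
  filterlim f F (locally l) <->
  filterlim (fun x => fst (f x)) F (locally (fst l)) /\
  filterlim (fun x => snd (f x)) F (locally (snd l)).
Proof.
split.
- intros H; split; apply filterlim_locally; intros eps;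
    apply (filter_imp (fun x => ball l eps (f x))); try now intros x [H1 H2].
  + now apply (proj1 (filterlim_locally f l)).
  + now apply (proj1 (filterlim_locally f l)).
- intros [H1 H2]; apply filterlim_locally; intros eps.
  apply (filter_imp (fun x => ball (fst l) eps (fst (f x)) /\
                              ball (snd l) eps (snd (f x)))).
  + now intros x [h1 h2]; split.
  + apply filter_and.
    * now apply (proj1 (filterlim_locally _ _) H1).
    * now apply (proj1 (filterlim_locally _ _) H2).
Qed.

Lemma CLim_seq_unique (u : nat -> C) (l : C) :
  filterlim u eventually (locally l) -> CLim_seq u = l.
Proof.
intros H; apply filterlim_C_iff in H; destruct H as [H1 H2].
unfold CLim_seq; rewrite (surjective_pairing l).
f_equal; [rewrite (is_lim_seq_unique _ (fst l)) | rewrite (is_lim_seq_unique _ (snd l))];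
  now simpl.
Qed.

Lemma fst_sum_n (u : nat -> C) (N : nat) :
  fst (sum_n u N) = sum_n (fun k => fst (u k)) N.
Proof.
induction N as [|N IH]; [now rewrite !sum_O|].
now rewrite !sum_Sn, <- IH.
Qed.

Lemma snd_sum_n (u : nat -> C) (N : nat) :
  snd (sum_n u N) = sum_n (fun k => snd (u k)) N.
Proof.
induction N as [|N IH]; [now rewrite !sum_O|].
now rewrite !sum_Sn, <- IH.
Qed.

Lemma is_series_C_iff (u : nat -> C) (l : C) :
  is_series u l <->
  is_series (fun k => fst (u k)) (fst l) /\ is_series (fun k => snd (u k)) (snd l).
Proof.
unfold is_series; rewrite (filterlim_C_iff (sum_n u) l).
assert (E1 : forall l', filterlim (fun N => fst (sum_n u N)) eventually (locally l') <->
                       filterlim (sum_n (fun k => fst (u k))) eventually (locally l')).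
{ intros l'; split; apply filterlim_ext; intros N; now rewrite fst_sum_n. }
assert (E2 : forall l', filterlim (fun N => snd (sum_n u N)) eventually (locally l') <->
                       filterlim (sum_n (fun k => snd (u k))) eventually (locally l')).
{ intros l'; split; apply filterlim_ext; intros N; now rewrite snd_sum_n. }
now rewrite (E1 (fst l)), (E2 (snd l)).
Qed.

Lemma CSeries_unique (u : nat -> C) (l : C) : is_series u l -> CSeries u = l.
Proof.
intros H; apply is_series_C_iff in H; destruct H as [H1 H2].
unfold CSeries; rewrite (surjective_pairing l).
f_equal; now apply is_series_unique.
Qed.

Lemma CSeries_correct (u : nat -> C) : ex_series u -> is_series u (CSeries u).
Proof. intros [l H]; now rewrite (CSeries_unique u l). Qed.

Lemma CSeries_ext (u v : nat -> C) : (forall k, u k = v k) -> CSeries u = CSeries v.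
Proof.
intros H; unfold CSeries; f_equal; apply Series_ext; intros k; now rewrite H.
Qed.

Lemma CSeries_scal_l (c : C) (u : nat -> C) :
  ex_series u -> CSeries (fun k => c * u k) = c * CSeries u.
Proof.
intros H; apply CSeries_unique; exact (is_series_scal_l c u _ (CSeries_correct u H)).
Qed.

Lemma CSeries_plus (u v : nat -> C) :
  ex_series u -> ex_series v ->
  CSeries (fun k => u k + v k) = CSeries u + CSeries v.
Proof.
intros Hu Hv; apply CSeries_unique.
exact (is_series_plus u v _ _ (CSeries_correct u Hu) (CSeries_correct v Hv)).
Qed.

Lemma CSeries_incr_1 (u : nat -> C) :
  ex_series u -> CSeries u = u O + CSeries (fun k => u (S k)).
Proof.
intros H; apply CSeries_unique, is_series_decr_1.
match goal with |- is_series _ ?l => replace l with (CSeries (fun k => u (S k))) end.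
- apply CSeries_correct; now apply (ex_series_incr_1 u).
- change (CSeries (fun k => u (S k)) = u O + CSeries (fun k => u (S k)) + - u O); ring.
Qed.

Lemma ex_series_Cmod_le (u : nat -> C) (b : nat -> R) :
  (forall k, Cmod (u k) <= b k)%R -> ex_series b -> ex_series u.
Proof.
intros H; apply (ex_series_le (K := C_AbsRing) (V := C_CompleteNormedModule)).
exact H.
Qed.

Lemma filterlim_Cmod (u : nat -> C) (l : C) :
  filterlim u eventually (locally l) ->
  is_lim_seq (fun k => Cmod (u k)) (Cmod l).
Proof.
intros H.
exact (filterlim_comp _ _ _ u norm _ _ _ H
         (filterlim_norm (K := C_AbsRing) (V := C_NormedModule) l)).
Qed.

(** The triangle inequality on partial sums, passed to the limit; domination by [b] also supplies
    the convergence of [u]. *)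
Lemma Cmod_CSeries_le (u : nat -> C) (b : nat -> R) :
  (forall k, Cmod (u k) <= b k)%R -> ex_series b -> (Cmod (CSeries u) <= Series b)%R.
Proof.
intros H Hb.
assert (Hu := CSeries_correct u (ex_series_Cmod_le u b H Hb)).
assert (Hb' := Series_correct b Hb).
assert (Hle : Rbar_le (Cmod (CSeries u)) (Series b)); [|exact Hle].
apply (is_lim_seq_le (fun N => Cmod (sum_n u N)) (sum_n b)).
- intros N; induction N as [|N IH]; [rewrite !sum_O; apply H|].
  rewrite !sum_Sn; eapply Rle_trans; [apply Cmod_triangle|].
  apply Rplus_le_compat; [apply IH | apply H].
- now apply filterlim_Cmod.
- exact Hb'.
Qed.

Lemma filterlim_Cmult {T : Type} {F : (T -> Prop) -> Prop} {FF : Filter F}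
    (f g : T -> C) (lf lg : C) :
  filterlim f F (locally lf) -> filterlim g F (locally lg) ->
  filterlim (fun x => f x * g x) F (locally (lf * lg)).
Proof.
intros Hf Hg.
apply filterlim_C_iff in Hf; apply filterlim_C_iff in Hg.
destruct Hf as [Hf1 Hf2], Hg as [Hg1 Hg2].
assert (M : forall (u v : T -> R) lu lv, filterlim u F (locally lu) ->
  filterlim v F (locally lv) -> filterlim (fun x => u x * v x)%R F (locally (lu * lv)%R)).
{ intros u v lu lv Hu Hv.
  exact (filterlim_comp_2 u v Rmult Hu Hv (filterlim_mult (K := R_AbsRing) lu lv)). }
assert (P : forall (u v : T -> R) lu lv, filterlim u F (locally lu) ->
  filterlim v F (locally lv) -> filterlim (fun x => u x + v x)%R F (locally (lu + lv)%R)).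
{ intros u v lu lv Hu Hv.
  exact (filterlim_comp_2 u v Rplus Hu Hv (filterlim_plus (V := R_NormedModule) lu lv)). }
assert (N : forall (u : T -> R) lu, filterlim u F (locally lu) ->
  filterlim (fun x => - u x)%R F (locally (- lu)%R)).
{ intros u lu Hu.
  exact (filterlim_comp _ _ _ u Ropp _ _ _ Hu (filterlim_opp (V := R_NormedModule) lu)). }
apply filterlim_C_iff; split; simpl.
- apply P; [now apply M | now apply N, M].
- now apply P; apply M.
Qed.

Lemma filterlim_RtoC (u : nat -> R) (l : R) :
  is_lim_seq u l -> filterlim (fun k => RtoC (u k)) eventually (locally (RtoC l)).
Proof.
intros H; apply filterlim_C_iff; split; [exact H | apply (is_lim_seq_const 0)].
Qed.

Lemma filterlim_Cplus {T : Type} {F : (T -> Prop) -> Prop} {FF : Filter F}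
    (f g : T -> C) (lf lg : C) :
  filterlim f F (locally lf) -> filterlim g F (locally lg) ->
  filterlim (fun x => f x + g x) F (locally (lf + lg)).
Proof.
intros Hf Hg.
exact (filterlim_comp_2 f g Cplus Hf Hg (filterlim_plus (V := C_NormedModule) lf lg)).
Qed.

(** * The complex exponential *)

Lemma Cmod_le_Rabs (z : C) : (Cmod z <= Rabs (fst z) + Rabs (snd z))%R.
Proof.
replace z with (RtoC (fst z) + Ci * RtoC (snd z)) at 1.
- eapply Rle_trans; [apply Cmod_triangle|].
  rewrite Cmod_mult, Cmod_Ci, !Cmod_R; lra.
- destruct z as [x y]; unfold Ci, Cmult, Cplus, RtoC; simpl; f_equal; ring.
Qed.

Lemma Rabs_fst_le_Cmod (z : C) : (Rabs (fst z) <= Cmod z)%R.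
Proof. eapply Rle_trans; [apply Rmax_l | apply Rmax_Cmod]. Qed.

Lemma Rabs_snd_le_Cmod (z : C) : (Rabs (snd z) <= Cmod z)%R.
Proof. eapply Rle_trans; [apply Rmax_r | apply Rmax_Cmod]. Qed.

Lemma Cexp_plus (a b : C) : Cexp (a + b) = Cexp a * Cexp b.
Proof.
unfold Cexp, Cplus, Cmult; simpl; rewrite exp_plus, cos_plus, sin_plus.
f_equal; ring.
Qed.

Lemma Cexp_RtoC (x : R) : Cexp x = exp x.
Proof.
unfold Cexp; simpl; rewrite cos_0, sin_0; unfold RtoC; f_equal; ring.
Qed.

Lemma Cmod_Cexp (z : C) : Cmod (Cexp z) = exp (fst z).
Proof.
unfold Cexp, Cmod; simpl.
replace (exp (fst z) * cos (snd z) * (exp (fst z) * cos (snd z) * 1) +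
         exp (fst z) * sin (snd z) * (exp (fst z) * sin (snd z) * 1))%R
  with (Rsqr (exp (fst z)) * (Rsqr (sin (snd z)) + Rsqr (cos (snd z))))%R
  by (unfold Rsqr; ring).
rewrite sin2_cos2, Rmult_1_r; apply sqrt_Rsqr.
apply Rlt_le, exp_pos.
Qed.

Lemma Cexp_neq_0 (z : C) : Cexp z <> 0.
Proof. apply Cmod_gt_0; rewrite Cmod_Cexp; apply exp_pos. Qed.

(** Everything follows from [1 + x <= exp x]: applied at [- x] it gives [exp x <= 1 / (1 - x)],
    which is at most [1 + x + 2 x^2] for [|x| <= 1/2]. *)
Lemma Rabs_exp_sub_1_sub_le (x : R) :
  (Rabs x <= / 2 -> Rabs (exp x - 1 - x) <= 2 * x ^ 2)%R.
Proof.
intros H; apply Rabs_le_between in H.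
assert (H1 := exp_ineq1_le x); assert (H2 := exp_ineq1_le (- x)).
assert (H3 : (exp x * exp (- x) = 1)%R) by (rewrite <- exp_plus, Rplus_opp_r; apply exp_0).
assert (H4 := exp_pos x).
assert (H5 : (exp x <= 1 + x + 2 * x ^ 2)%R); [|apply Rabs_le_between; nra].
apply Rmult_le_reg_r with (1 - x)%R; [lra|].
apply Rle_trans with (exp x * exp (- x))%R; [apply Rmult_le_compat_l; lra|].
rewrite H3.
replace ((1 + x + 2 * x ^ 2) * (1 - x))%R with (1 + x ^ 2 * (1 - 2 * x))%R by ring.
assert (0 <= x ^ 2)%R by apply pow2_ge_0; nra.
Qed.

Lemma Rabs_sin_le (y : R) : (Rabs (sin y) <= Rabs y)%R.
Proof.
destruct (MVT_gen sin 0 y cos) as [c [_ Hc]].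
- intros x _; apply is_derive_sin.
- intros x _; apply continuity_sin.
- rewrite sin_0, !Rminus_0_r in Hc; rewrite Hc, Rabs_mult.
  assert (Hb := COS_bound c).
  assert (Rabs (cos c) <= 1)%R by (apply Rabs_le_between; lra).
  assert (Hy := Rabs_pos y); nra.
Qed.

Lemma Rabs_cos_sub_1_le (y : R) : (Rabs (cos y - 1) <= y ^ 2)%R.
Proof.
replace y with (2 * (y / 2))%R at 1 by field; rewrite cos_2a_sin.
replace (1 - 2 * sin (y / 2) * sin (y / 2) - 1)%R
  with (- (2 * sin (y / 2) ^ 2))%R by ring.
rewrite Rabs_Ropp, Rabs_pos_eq by (assert (H := pow2_ge_0 (sin (y / 2))); lra).
assert (H := Rabs_sin_le (y / 2)).
apply pow_maj_Rabs with (n := 2%nat) in H; rewrite pow2_abs in H.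
assert (H' := pow2_ge_0 y); nra.
Qed.

(** The mean value theorem for [sin t - t] yields the cubic bound [|y|^3], and [|y| <= 1] turns it
    into a square. *)
Lemma Rabs_sin_sub_le (y : R) : (Rabs y <= 1 -> Rabs (sin y - y) <= y ^ 2)%R.
Proof.
intros Hy.
destruct (MVT_gen (fun t => sin t - t)%R 0 y (fun t => cos t - 1)%R) as [c [Hc1 Hc]].
- intros x _; auto_derive; [trivial | ring].
- intros x _; apply continuity_pt_filterlim.
  apply (ex_derive_continuous (fun t => sin t - t)%R); auto_derive; trivial.
- rewrite sin_0, !Rminus_0_r in Hc; rewrite Hc, Rabs_mult.
  assert (Hb := Rabs_cos_sub_1_le c).
  assert (Hcy : (Rabs c <= Rabs y)%R).
  { unfold Rmin, Rmax in Hc1; unfold Rabs; destruct (Rle_dec 0 y);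
    destruct (Rcase_abs c); destruct (Rcase_abs y); lra. }
  assert (Hp := Rabs_pos c); assert (Hq := Rabs_pos y).
  rewrite <- (pow2_abs y); rewrite <- (pow2_abs c) in Hb.
  nra.
Qed.

Lemma Cmod_Cexp_sub_1_sub_le (w : C) :
  (Cmod w <= / 2)%R -> (Cmod (Cexp w - 1 - w) <= 10 * Cmod w ^ 2)%R.
Proof.
intros Hw.
assert (Hx := Rabs_fst_le_Cmod w); assert (Hy := Rabs_snd_le_Cmod w).
eapply Rle_trans; [apply Cmod_le_Rabs|].
destruct w as [x y]; set (m := Cmod (x, y)) in *; simpl fst in *; simpl snd in *.
assert (Hm := Rabs_pos x); assert (Hm' := Rabs_pos y).
assert (E1 := Rabs_exp_sub_1_sub_le x ltac:(lra)).
assert (E2 := Rabs_cos_sub_1_le y).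
assert (E3 := Rabs_sin_sub_le y ltac:(lra)).
assert (E4 := Rabs_sin_le y).
rewrite <- (pow2_abs x) in E1; rewrite <- (pow2_abs y) in E2, E3.
assert (E5 : (Rabs (exp x - 1) <= 2 * m)%R).
{ replace (exp x - 1)%R with ((exp x - 1 - x) + x)%R by ring.
  eapply Rle_trans; [apply Rabs_triang|]; nra. }
assert (E6 : (Rabs (exp x) <= 2)%R).
{ replace (exp x) with (1 + (exp x - 1))%R by ring.
  eapply Rle_trans; [apply Rabs_triang|]; rewrite Rabs_R1; lra. }
assert (E7 := Rabs_pos (exp x)).
(* Each component is split into remainders already bounded: the real part costs [4 m^2], the
   imaginary part [3 m^2], which the constant 10 covers. *)
replace (exp x * cos y + - (1) + - x)%R
  with ((exp x - 1 - x) + exp x * (cos y - 1))%R by ring.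
replace (exp x * sin y + - 0 + - y)%R
  with ((exp x - 1) * sin y + (sin y - y))%R by ring.
assert (F1 := Rabs_triang (exp x - 1 - x) (exp x * (cos y - 1))).
assert (F2 := Rabs_triang ((exp x - 1) * sin y) (sin y - y)).
rewrite Rabs_mult in F1, F2.
assert (G1 : (Rabs x ^ 2 <= m ^ 2)%R) by nra.
assert (G2 : (Rabs y ^ 2 <= m ^ 2)%R) by nra.
assert (G3 : (Rabs (exp x) * Rabs (cos y - 1) <= 2 * m ^ 2)%R)
  by (apply Rmult_le_compat; try apply Rabs_pos; lra).
assert (G4 : (Rabs (exp x - 1) * Rabs (sin y) <= (2 * m) * m)%R)
  by (apply Rmult_le_compat; try apply Rabs_pos; lra).
nra.
Qed.

(** * The reciprocal gamma function *)

(* The total error [c 0 <= 1/2] keeps every partial product between one half and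
   twice the first one; the lower bound is what makes the limit nonzero. *)
Lemma infinite_product_cv (u d : nat -> C) (c : nat -> R) :
  (forall k, u (S k) = u k * (1 + d k)) ->
  (forall k, Cmod (d k) <= c k - c (S k))%R ->
  (forall k, 0 <= c k)%R -> (c O <= / 2)%R ->
  exists l : C, filterlim u eventually (locally l) /\ (u O <> 0 -> l <> 0).
Proof.
intros Hu Hd Hc Hc0.
assert (Hmono : forall k, (c k <= c O)%R).
{ induction k as [|k IH]; [lra|].
  assert (H := Hd k); assert (H' := Cmod_ge_0 (d k)); lra. }
(* With [t = c 0 - c k] and [e = |d k|], the induction step is [(1 + 2t)(1 + e) <= 1 + 2(t + e)],
   which uses [2t <= 1]. *)
assert (Hup : forall k, (Cmod (u k) <= Cmod (u O) * (1 + 2 * (c O - c k)))%R).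
{ induction k as [|k IH]; [lra|].
  rewrite Hu, Cmod_mult.
  assert (H1 := Cmod_triangle 1 (d k)); rewrite Cmod_1 in H1.
  assert (H2 := Hd k); assert (H3 := Cmod_ge_0 (d k)); assert (H4 := Hc k).
  assert (H5 := Cmod_ge_0 (1 + d k)); assert (H6 := Cmod_ge_0 (u k)).
  assert (H7 := Cmod_ge_0 (u O)); assert (H8 := Hmono k).
  eapply Rle_trans.
  - apply Rmult_le_compat; [easy | easy | exact IH | apply H1].
  - rewrite Rmult_assoc; apply Rmult_le_compat_l; [easy | nra]. }
(* Weierstrass's inequality: [(1 - t)(1 - e) >= 1 - (t + e)]. *)
assert (Hlow : forall k, (Cmod (u O) * (1 - (c O - c k)) <= Cmod (u k))%R).
{ induction k as [|k IH]; [lra|].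
  rewrite Hu, Cmod_mult.
  assert (H1 : (1 - Cmod (d k) <= Cmod (1 + d k))%R).
  { assert (H := Cmod_triangle (1 + d k) (- d k)); rewrite Cmod_opp in H.
    replace (1 + d k + - d k) with (RtoC 1) in H by ring.
    rewrite Cmod_1 in H; lra. }
  assert (H2 := Hd k); assert (H3 := Cmod_ge_0 (d k)); assert (H4 := Hc k).
  assert (H4' := Hc (S k)); assert (H7 := Cmod_ge_0 (u O)); assert (H8 := Hmono k).
  eapply Rle_trans; [|apply Rmult_le_compat; [| |exact IH|exact H1]].
  - rewrite Rmult_assoc; apply Rmult_le_compat_l; [easy | nra].
  - apply Rmult_le_pos; lra.
  - lra. }
(* The increments [u k * d k] are dominated by [2 |u 0|] times the telescoping differences of [c],
   which is decreasing and bounded below. *)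
assert (Hser : ex_series (fun k => u (S k) - u k)).
{ apply ex_series_Cmod_le with (fun k => 2 * Cmod (u O) * (c k - c (S k)))%R.
  - intros k; rewrite Hu; replace (u k * (1 + d k) - u k) with (u k * d k) by ring.
    rewrite Cmod_mult; apply Rmult_le_compat; try apply Cmod_ge_0; [|apply Hd].
    eapply Rle_trans; [apply Hup|]; rewrite (Rmult_comm 2 (Cmod (u O))).
    apply Rmult_le_compat_l; [apply Cmod_ge_0|].
    assert (H := Hc k); assert (H' := Hmono k); lra.
  - apply (ex_series_scal_l (V := R_NormedModule)).
    destruct (ex_finite_lim_seq_decr c 0) as [lc Hlc]; [|exact Hc|].
    { intros k; assert (H := Hd k); assert (H' := Cmod_ge_0 (d k)); lra. }
    exists (c O - lc)%R.
    apply filterlim_ext with (fun k => c O - c (S k))%R.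
    { induction x as [|k IH]; [now rewrite sum_O|].
      rewrite sum_Sn, <- IH; unfold plus; simpl; ring. }
    apply (is_lim_seq_minus' (fun _ => c O) (fun k => c (S k))).
    + apply is_lim_seq_const.
    + now apply is_lim_seq_incr_1 in Hlc. }
destruct Hser as [l Hl].
(* The partial sum of the increments up to [k] is [u (k + 1) - u 0], whence the shift by one in each
   component. *)
assert (Hlim : filterlim u eventually (locally (u O + l))).
{ apply filterlim_C_iff.
  apply is_series_C_iff in Hl; destruct Hl as [Hl1 Hl2]; split.
  - apply (proj2 (is_lim_seq_incr_1 (fun k => fst (u k)) (Finite (fst (u O + l))))).
    apply is_lim_seq_ext with (fun k => fst (u O) + sum_n (fun k => fst (u (S k)) - fst (u k)) k)%R.
    + induction n as [|k IH]; [rewrite sum_O; simpl; ring|].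
      rewrite sum_Sn; unfold plus; simpl in *; lra.
    + apply is_lim_seq_plus'; [apply is_lim_seq_const | exact Hl1].
  - apply (proj2 (is_lim_seq_incr_1 (fun k => snd (u k)) (Finite (snd (u O + l))))).
    apply is_lim_seq_ext with (fun k => snd (u O) + sum_n (fun k => snd (u (S k)) - snd (u k)) k)%R.
    + induction n as [|k IH]; [rewrite sum_O; simpl; ring|].
      rewrite sum_Sn; unfold plus; simpl in *; lra.
    + apply is_lim_seq_plus'; [apply is_lim_seq_const | exact Hl2]. }
exists (u O + l); split; [exact Hlim|].
intros H0; apply Cmod_gt_0; apply Cmod_gt_0 in H0.
assert (H : Rbar_le (Cmod (u O) / 2)%R (Cmod (u O + l))).
{ apply (is_lim_seq_le (fun _ => Cmod (u O) / 2)%R (fun k => Cmod (u k))).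
  - intros k; eapply Rle_trans; [|apply Hlow].
    assert (H := Hc k); nra.
  - apply is_lim_seq_const.
  - now apply filterlim_Cmod. }
simpl in H; lra.
Qed.

Lemma ln_succ_sub_ln_bounds (p : nat) :
  (1 <= p)%nat ->
  (/ INR (S p) <= ln (INR (S p)) - ln (INR p) <= / INR p)%R.
Proof.
intros Hp; apply le_INR in Hp; simpl (INR 1) in Hp.
assert (ES : INR (S p) = (INR p + 1)%R) by apply S_INR.
(* Both bounds are this inequality, at [p / (p + 1)] and at [(p + 1) / p]. *)
assert (H : forall x : R, (0 < x)%R -> (ln x <= x - 1)%R).
{ intros x Hx; assert (H := exp_ineq1_le (ln x)); rewrite exp_ln in H; lra. }
split.
- assert (H1 := H (INR p / INR (S p))%R ltac:(apply Rdiv_lt_0_compat; lra)).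
  rewrite ln_div in H1 by lra.
  replace (INR p / INR (S p) - 1)%R with (- / INR (S p))%R in H1
    by (rewrite ES; field; lra).
  lra.
- assert (H1 := H (INR (S p) / INR p)%R ltac:(apply Rdiv_lt_0_compat; lra)).
  rewrite ln_div in H1 by lra.
  replace (INR (S p) / INR p - 1)%R with (/ INR p)%R in H1
    by (rewrite ES; field; lra).
  lra.
Qed.

(** The ratio of consecutive Euler-Gauss terms is [(1 + z/(p+1)) (p/(p+1))^z]; this is its deviation
    from 1. *)
Definition Gauss_error (z : C) (p : nat) : C :=
  (1 + z * RtoC (/ INR (S p))) * Cexp (z * RtoC (ln (INR p) - ln (INR (S p)))) - 1.

Lemma RtoC_neq_0 (x : R) : x <> 0%R -> RtoC x <> 0.
Proof. intros H E; apply H; now injection E. Qed.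

Lemma rGamma_seq_S (z : C) (p : nat) :
  (1 <= p)%nat -> rGamma_seq z (S p) = rGamma_seq z p * (1 + Gauss_error z p).
Proof.
intros Hp; unfold rGamma_seq, Gauss_error.
assert (H1 : RtoC (INR (fact p)) <> 0) by (apply RtoC_neq_0, INR_fact_neq_0).
assert (H2 : RtoC (INR (S p)) <> 0) by (apply RtoC_neq_0, not_0_INR; lia).
assert (E : Cexp (z * ln (INR p)) =
  Cexp (z * ln (INR (S p))) * Cexp (z * RtoC (ln (INR p) - ln (INR (S p))))).
{ rewrite <- Cexp_plus; f_equal; rewrite RtoC_minus; ring. }
rewrite E, RtoC_inv by (apply not_0_INR; lia).
rewrite fact_simpl, mult_INR, RtoC_mult.
change (Cprod (fun i => z + INR i) (S p))
  with (Cprod (fun i => z + INR i) p * (z + INR (S p))).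
field; repeat split; try apply Cexp_neq_0; auto.
Qed.

(** The first-order terms [z/(p+1)] and [- z (ln (p+1) - ln p)] nearly cancel, and the rest is
    quadratic in [z/p]. The bound is a difference of consecutive terms because [infinite_product_cv]
    needs a telescoping majorant. *)
Lemma Gauss_error_le (z : C) (p : nat) :
  (1 <= p)%nat -> (2 * Cmod z <= INR p)%R ->
  (Cmod (Gauss_error z p) <=
   (Cmod z + 42 * Cmod z ^ 2) * (/ INR p - / INR (S p)))%R.
Proof.
intros Hp Hz.
assert (HL := ln_succ_sub_ln_bounds p Hp).
apply le_INR in Hp; simpl (INR 1) in Hp.
assert (ES : INR (S p) = (INR p + 1)%R) by apply S_INR.
set (L := (ln (INR (S p)) - ln (INR p))%R) in HL.
unfold Gauss_error.
replace (ln (INR p) - ln (INR (S p)))%R with (- L)%R by (unfold L; ring).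
set (t := (/ INR (S p))%R) in *.
set (q := (/ INR p)%R) in *.
assert (Ht : (0 < t)%R) by (apply Rinv_0_lt_compat; lra).
assert (Hq : (q <= 1)%R) by (rewrite <- Rinv_1; apply Rinv_le_contravar; lra).
assert (Hqt : (q - t = q * t)%R) by (unfold q, t; rewrite ES; field; lra).
(* From [q <= 1], [q - t = q t <= t], so [q <= 2t]; this converts every quadratic term into the
   telescoping quantity [q - t]. *)
assert (Hq2 : (q ^ 2 <= 2 * (q - t))%R) by nra.
assert (Hzq : (Cmod z * q <= / 2)%R).
{ unfold q; apply Rmult_le_reg_r with (INR p); [lra|].
  rewrite Rmult_assoc, Rinv_l by lra; lra. }
assert (Hz0 := Cmod_ge_0 z).
set (w := z * RtoC (- L)).
assert (Hw : (Cmod w <= Cmod z * q)%R).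
{ unfold w; rewrite Cmod_mult, Cmod_R, Rabs_Ropp, Rabs_pos_eq by lra.
  apply Rmult_le_compat_l; lra. }
assert (HE := Cmod_Cexp_sub_1_sub_le w ltac:(lra)).
set (r := Cexp w - 1 - w) in *.
(* The three pieces below contribute [|z|], [2 |z|^2] and [40 |z|^2] times [q - t], which add up to
   the stated constant. *)
replace (Cexp w) with (1 + w + r) by (unfold r; ring).
replace ((1 + z * RtoC t) * (1 + w + r) - 1)
  with (z * RtoC (t - L) + (z * RtoC t * w + (1 + z * RtoC t) * r)).
2: { unfold w; rewrite RtoC_minus, RtoC_opp; ring. }
assert (Hw0 := Cmod_ge_0 w).
eapply Rle_trans; [apply Cmod_triangle|].
eapply Rle_trans; [apply Rplus_le_compat_l, Cmod_triangle|].
rewrite !Cmod_mult, !Cmod_R.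
assert (H1 := Cmod_triangle 1 (z * RtoC t)).
rewrite Cmod_1, Cmod_mult, Cmod_R, (Rabs_pos_eq t) in H1 by lra.
rewrite (Rabs_pos_eq t) by lra.
rewrite (Rabs_minus_sym t L), (Rabs_pos_eq (L - t)) by lra.
assert (Hw2 : (Cmod w ^ 2 <= 2 * Cmod z ^ 2 * (q - t))%R).
{ apply Rle_trans with ((Cmod z * q) ^ 2)%R; [now apply pow_incr|].
  rewrite Rpow_mult_distr; assert (H := pow2_ge_0 (Cmod z)); nra. }
assert (A1 : (Cmod z * (L - t) <= Cmod z * (q - t))%R) by (apply Rmult_le_compat_l; lra).
assert (A2 : (Cmod z * t * Cmod w <= 2 * Cmod z ^ 2 * (q - t))%R).
{ apply Rle_trans with ((Cmod z * q) * (Cmod z * q))%R.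
  - apply Rmult_le_compat; try easy; [apply Rmult_le_pos; lra|].
    apply Rmult_le_compat_l; lra.
  - assert (H := pow2_ge_0 (Cmod z)); nra. }
assert (A3 : (Cmod (1 + z * RtoC t) * Cmod r <= 2 * (10 * (2 * Cmod z ^ 2 * (q - t))))%R).
{ apply Rmult_le_compat; try apply Cmod_ge_0; [|lra].
  assert (Cmod z * t <= Cmod z * q)%R by (apply Rmult_le_compat_l; lra); lra. }
lra.
Qed.

Lemma Cprod_neq_0 (f : nat -> C) (n : nat) :
  (forall i, (1 <= i <= n)%nat -> f i <> 0) -> Cprod f n <> 0.
Proof.
induction n as [|n IH]; intros H; simpl; [apply C1_nz|].
apply Cmult_neq_0; [apply IH; intros i Hi|]; apply H; lia.
Qed.

Lemma rGamma_seq_neq_0 (z : C) (p : nat) :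
  (forall m : nat, z <> RtoC (- INR m)) -> rGamma_seq z p <> 0.
Proof.
intros Hz; unfold rGamma_seq.
assert (Hi : forall i, z + INR i <> 0).
{ intros i E; apply (Hz i); rewrite RtoC_opp.
  replace z with (z + INR i - INR i) by ring; rewrite E; ring. }
apply Cmult_neq_0; [apply Cmult_neq_0|].
- intros E; apply (Hz O); rewrite E; simpl; now rewrite Ropp_0.
- now apply Cprod_neq_0.
- assert (H : INR (fact p) * Cexp (z * ln (INR p)) <> 0).
  { apply Cmult_neq_0; [apply RtoC_neq_0, INR_fact_neq_0 | apply Cexp_neq_0]. }
  intros E; apply C1_nz; rewrite <- (Cinv_r _ H), E; ring.
Qed.

Lemma rGamma_seq_cv (z : C) :
  exists l : C, filterlim (rGamma_seq z) eventually (locally l) /\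
            ((forall m : nat, z <> RtoC (- INR m)) -> l <> 0).
Proof.
set (K := (Cmod z + 42 * Cmod z ^ 2)%R).
assert (Hz0 := Cmod_ge_0 z).
assert (HK : (0 <= K)%R) by (unfold K; assert (H := pow2_ge_0 (Cmod z)); lra).
(* Starting at [N' = N + 1] makes the total error [K / N'] at most one half and meets the condition
   [2 |z| <= p] of [Gauss_error_le]. *)
destruct (nfloor_ex (2 * K + 2 * Cmod z + 1)%R) as [N [_ HN]]; [lra|].
set (N' := S N); assert (EN : INR N' = (INR N + 1)%R) by apply S_INR.
destruct (infinite_product_cv (fun k => rGamma_seq z (k + N'))
  (fun k => Gauss_error z (k + N')) (fun k => K * / INR (k + N'))%R) as [l [Hl Hl0]].
- intros k; apply (rGamma_seq_S z (k + N')); unfold N'; lia.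
- intros k; change (S k + N')%nat with (S (k + N')).
  rewrite <- Rmult_minus_distr_l; apply Gauss_error_le; [unfold N'; lia|].
  rewrite plus_INR; assert (H := pos_INR k); lra.
- intros k; apply Rmult_le_pos; [exact HK|]; apply Rlt_le, Rinv_0_lt_compat.
  apply lt_0_INR; unfold N'; lia.
- change (0 + N')%nat with N'; apply Rmult_le_reg_r with (INR N'); [lra|].
  rewrite Rmult_assoc, Rinv_l by lra; lra.
- exists l; split.
  + apply filterlim_C_iff; apply filterlim_C_iff in Hl; destruct Hl as [Hl1 Hl2]; split.
    * exact (proj2 (is_lim_seq_incr_n (fun k => fst (rGamma_seq z k)) N' (Finite (fst l))) Hl1).
    * exact (proj2 (is_lim_seq_incr_n (fun k => snd (rGamma_seq z k)) N' (Finite (snd l))) Hl2).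
  + intros Hz; apply Hl0; now apply rGamma_seq_neq_0.
Qed.

Lemma rGamma_seq_lim (z : C) : filterlim (rGamma_seq z) eventually (locally (rGamma z)).
Proof.
destruct (rGamma_seq_cv z) as [l [Hl _]].
unfold rGamma; now rewrite (CLim_seq_unique _ l).
Qed.

Lemma rGamma_neq_0 (z : C) : (forall m : nat, z <> RtoC (- INR m)) -> rGamma z <> 0.
Proof.
intros Hz; destruct (rGamma_seq_cv z) as [l [Hl Hl0]].
unfold rGamma; rewrite (CLim_seq_unique _ l Hl); now apply Hl0.
Qed.

Lemma Cprod_ext (f g : nat -> C) (n : nat) :
  (forall i, (1 <= i <= n)%nat -> f i = g i) -> Cprod f n = Cprod g n.
Proof.
induction n as [|n IH]; intros H; simpl; [easy|].
rewrite IH, H; [easy | lia | intros i Hi; apply H; lia].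
Qed.

Lemma Cprod_shift (f : nat -> C) (n : nat) :
  Cprod f (S n) = f 1%nat * Cprod (fun i => f (S i)) n.
Proof.
induction n as [|n IH]; [simpl; ring|].
change (Cprod f (S (S n))) with (Cprod f (S n) * f (S (S n))).
rewrite IH; simpl; ring.
Qed.

(** The products [z ... (z+m)] and [(z+1) ... (z+1+m)] differ by one factor at each end, and
    [m^(z+1) = m^z m]; the correction [(z+1+m)/m] tends to 1. *)
Lemma rGamma_seq_succ (z : C) (m : nat) :
  (1 <= m)%nat ->
  rGamma_seq z m * (1 + (z + 1) * RtoC (/ INR m)) = z * rGamma_seq (z + 1) m.
Proof.
intros Hm; unfold rGamma_seq.
assert (H1 : RtoC (INR (fact m)) <> 0) by (apply RtoC_neq_0, INR_fact_neq_0).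
assert (H2 : INR m <> 0%R) by (apply not_0_INR; lia).
assert (H3 : (0 < INR m)%R) by (apply lt_0_INR; lia).
assert (E : Cexp ((z + 1) * ln (INR m)) = Cexp (z * ln (INR m)) * INR m).
{ replace (RtoC (INR m)) with (Cexp (ln (INR m)))
    by now rewrite Cexp_RtoC, exp_ln.
  rewrite <- Cexp_plus.
  f_equal; ring. }
assert (F : (z + 1) * Cprod (fun i => z + 1 + INR i) m =
            Cprod (fun i => z + INR i) m * (z + INR m + 1)).
{ assert (F := Cprod_shift (fun i => z + INR i) m).
  rewrite (Cprod_ext (fun i => z + 1 + INR i) (fun i => z + INR (S i))).
  - change (Cprod (fun i => z + INR i) (S m)) with
      (Cprod (fun i => z + INR i) m * (z + INR (S m))) in F.
    cbv beta in F; change (INR 1) with 1%R in F; rewrite <- F, S_INR, RtoC_plus; ring.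
  - intros i _; rewrite S_INR, RtoC_plus; ring. }
rewrite F, E, RtoC_inv by exact H2.
field; repeat split; [now apply RtoC_neq_0 | apply Cexp_neq_0 | easy].
Qed.

Lemma is_lim_seq_inv_INR : is_lim_seq (fun m => / INR m)%R 0.
Proof.
replace (Finite 0) with (Rbar_inv p_infty) by easy.
apply is_lim_seq_inv; [apply is_lim_seq_INR | easy].
Qed.

(** Limit of [rGamma_seq_succ]. No gamma value is inverted, so the identity also covers the poles of
    [Gamma]. *)
Lemma rGamma_succ (z : C) : rGamma z = z * rGamma (z + 1).
Proof.
rewrite <- (CLim_seq_unique (fun m => z * rGamma_seq (z + 1) m) (z * rGamma (z + 1))).
- symmetry; apply CLim_seq_unique.
  apply filterlim_ext_loc with
    (fun m => rGamma_seq z m * (1 + (z + 1) * RtoC (/ INR m))).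
  { exists 1%nat; intros m Hm; now apply rGamma_seq_succ. }
  replace (rGamma z) with (rGamma z * (1 + (z + 1) * RtoC 0)) by ring.
  apply filterlim_Cmult; [apply rGamma_seq_lim|].
  apply filterlim_Cplus; [apply filterlim_const|].
  apply filterlim_Cmult; [apply filterlim_const|].
  apply filterlim_RtoC, is_lim_seq_inv_INR.
- apply filterlim_Cmult; [apply filterlim_const | apply rGamma_seq_lim].
Qed.

Lemma rGamma_1 : rGamma 1 = 1.
Proof.
apply CLim_seq_unique.
apply filterlim_ext_loc with (fun m => 1 + RtoC (/ INR m)).
- exists 1%nat; intros m Hm; unfold rGamma_seq.
  assert (H1 : RtoC (INR (fact m)) <> 0) by (apply RtoC_neq_0, INR_fact_neq_0).
  assert (H2 : INR m <> 0%R) by (apply not_0_INR; lia).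
  assert (H3 : (0 < INR m)%R) by (apply lt_0_INR; lia).
  rewrite !Cmult_1_l, Cexp_RtoC, exp_ln by easy.
  assert (F : Cprod (fun i => 1 + INR i) m = INR (fact (S m))).
  { clear; induction m as [|m IH]; [now simpl|].
    change (Cprod (fun i => 1 + INR i) (S m)) with
      (Cprod (fun i => 1 + INR i) m * (1 + INR (S m))).
    rewrite IH, (fact_simpl (S m)), mult_INR, RtoC_mult, (S_INR (S m)), RtoC_plus; ring. }
  rewrite F, fact_simpl, mult_INR, RtoC_mult, S_INR, RtoC_plus, RtoC_inv by easy.
  field; split; [now apply RtoC_neq_0 | easy].
- assert (H : filterlim (fun m => 1 + RtoC (/ INR m)) eventually (locally (1 + 0))).
  { apply filterlim_Cplus; [apply filterlim_const|].
    apply filterlim_RtoC, is_lim_seq_inv_INR. }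
  now rewrite Cplus_0_r in H.
Qed.

(** It turns the factor belonging to [a_1 = 0] into the weight [1/k!] of an exponential series. *)
Lemma rGamma_INR_succ (k : nat) : rGamma (INR k + 1) = / INR (fact k).
Proof.
induction k as [|k IH]; [simpl INR; rewrite Cplus_0_l, rGamma_1; field; apply C1_nz|].
assert (H : RtoC (INR (S k)) <> 0) by (apply RtoC_neq_0, not_0_INR; lia).
assert (H1 : RtoC (INR (fact k)) <> 0) by (apply RtoC_neq_0, INR_fact_neq_0).
rewrite rGamma_succ, <- RtoC_plus, <- S_INR in IH.
rewrite fact_simpl, mult_INR, RtoC_mult.
apply (f_equal (fun x => / INR (S k) * x)) in IH.
rewrite Cmult_assoc, Cinv_l, Cmult_1_l in IH by easy.
rewrite IH; field; auto.
Qed.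

(** Induction on [K] for all [f] at once: dropping the first term lowers [K] by one, and enlarging
    the constant restores that term. *)
Lemma eventually_geometric_bound (r : R) (f : nat -> R) (K : nat) :
  (0 < r)%R -> (forall k, (K <= k)%nat -> f (S k) <= r * f k)%R ->
  exists M, (0 <= M)%R /\ forall k, (f k <= M * r ^ k)%R.
Proof.
intros Hr; revert f; induction K as [|K IH]; intros f Hf.
- exists (Rmax 0 (f O)); split; [apply Rmax_l|].
  induction k as [|k IHk]; [simpl; rewrite Rmult_1_r; apply Rmax_r|].
  eapply Rle_trans; [apply Hf; lia|]; simpl; nra.
- destruct (IH (fun k => f (S k))) as [M [HM HMk]]; [intros k Hk; apply Hf; lia|].
  assert (Hir := Rinv_0_lt_compat r Hr).
  exists (Rmax (f O) (M / r))%R; split.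
  + eapply Rle_trans; [|apply Rmax_r]; apply Rmult_le_pos; lra.
  + intros [|k]; [simpl; rewrite Rmult_1_r; apply Rmax_l|].
    eapply Rle_trans; [apply HMk|].
    replace (M * r ^ k)%R with (M / r * r ^ S k)%R by (simpl; field; lra).
    apply Rmult_le_compat_r; [apply pow_le; lra | apply Rmax_r].
Qed.

Lemma rGamma_geometric_decay (c : C) (r : R) :
  (0 < r)%R ->
  exists M, (0 <= M)%R /\ forall k, (Cmod (rGamma (INR k + c)) <= M * r ^ k)%R.
Proof.
intros Hr.
assert (Hir := Rinv_0_lt_compat r Hr); assert (Hc := Cmod_ge_0 c).
(* Beyond this index [|k + c| >= k - |c| >= 1/r], so the functional equation shrinks the modulus by
   a factor at most [r]. *)
destruct (nfloor_ex (/ r + Cmod c)%R) as [N [_ HN]]; [lra|].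
apply eventually_geometric_bound with (S N); [exact Hr|].
intros k Hk; apply le_INR in Hk; rewrite S_INR in Hk.
rewrite (rGamma_succ (INR k + c)), Cmod_mult, S_INR, RtoC_plus.
replace (INR k + 1 + c) with (INR k + c + 1) by ring.
assert (H : (/ r <= Cmod (INR k + c))%R).
{ assert (H := Cmod_triangle (INR k + c) (- c)); rewrite Cmod_opp in H.
  replace (INR k + c + - c) with (RtoC (INR k)) in H by ring.
  rewrite Cmod_R, Rabs_pos_eq in H by apply pos_INR; lra. }
rewrite <- Rmult_assoc; rewrite <- (Rmult_1_l (Cmod _)) at 1.
apply Rmult_le_compat_r; [apply Cmod_ge_0|].
rewrite <- (Rinv_r r) by lra; apply Rmult_le_compat_l; lra.
Qed.

Lemma Cprod_rGamma_geometric_decay (n : nat) (c : nat -> C) (r : R) :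
  (0 < r)%R -> (1 <= n)%nat ->
  exists M, (0 <= M)%R /\
    forall k, (Cmod (Cprod (fun j => rGamma (INR k + c j)) n) <= M * r ^ k)%R.
Proof.
intros Hr Hn; destruct n as [|n]; [lia | clear Hn].
induction n as [|n [M [HM H]]].
- destruct (rGamma_geometric_decay (c 1%nat) r Hr) as [M [HM H]].
  exists M; split; [easy|]; intros k; simpl; rewrite Cmult_1_l; apply H.
(* The first factor already provides [r ^ k]; each further one only has to be bounded, hence the
   ratio 1. *)
- destruct (rGamma_geometric_decay (c (S (S n))) 1 Rlt_0_1) as [M' [HM' H']].
  exists (M * M')%R; split; [now apply Rmult_le_pos|]; intros k.
  change (Cprod (fun j => rGamma (INR k + c j)) (S (S n))) with
    (Cprod (fun j => rGamma (INR k + c j)) (S n) * rGamma (INR k + c (S (S n)))).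
  rewrite Cmod_mult.
  replace (M * M' * r ^ k)%R with (M * r ^ k * (M' * 1 ^ k))%R by (rewrite pow1; ring).
  apply Rmult_le_compat; try apply Cmod_ge_0; auto.
Qed.

(** * Laplace transforms of exponential power series *)

(** Componentwise, so that the real theorems on derivatives, power series and integrals apply
    directly. *)
Definition is_Cderive (f : R -> C) (x : R) (l : C) : Prop :=
  is_derive (fun t => fst (f t)) x (fst l) /\ is_derive (fun t => snd (f t)) x (snd l).

Lemma is_Cderive_const (c : C) (x : R) : is_Cderive (fun _ => c) x 0.
Proof. split; apply (is_derive_const (V := R_NormedModule)). Qed.

Lemma is_Cderive_mult (f g : R -> C) (x : R) (df dg : C) :
  is_Cderive f x df -> is_Cderive g x dg ->
  is_Cderive (fun t => f t * g t) x (df * g x + f x * dg).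
Proof.
intros [f1 f2] [g1 g2].
assert (M : forall (u v : R -> R) du dv, is_derive u x du -> is_derive v x dv ->
  is_derive (fun t => u t * v t)%R x (du * v x + u x * dv)%R).
{ intros u v du dv Hu Hv; apply (is_derive_mult u v x du dv Hu Hv).
  intros a b; apply Rmult_comm. }
split; simpl.
- replace (fst df * fst (g x) - snd df * snd (g x) +
           (fst (f x) * fst dg - snd (f x) * snd dg))%R
    with (fst df * fst (g x) + fst (f x) * fst dg -
          (snd df * snd (g x) + snd (f x) * snd dg))%R by ring.
  apply (is_derive_minus (V := R_NormedModule) (fun t => fst (f t) * fst (g t))%R
    (fun t => snd (f t) * snd (g t))%R); now apply M.
- replace (fst df * snd (g x) + snd df * fst (g x) +
           (fst (f x) * snd dg + snd (f x) * fst dg))%R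
    with (fst df * snd (g x) + fst (f x) * snd dg +
          (snd df * fst (g x) + snd (f x) * fst dg))%R by ring.
  apply (is_derive_plus (V := R_NormedModule) (fun t => fst (f t) * snd (g t))%R
    (fun t => snd (f t) * fst (g t))%R); now apply M.
Qed.

Lemma is_Cderive_Cexp (s : C) (x : R) :
  is_Cderive (fun t => Cexp (- (s * t))) x (- s * Cexp (- (s * x))).
Proof.
destruct s as [a b]; split; simpl; auto_derive; trivial; unfold Rminus; ring.
Qed.

(** The fundamental theorem of calculus in each component; differentiability of [df] serves to give
    its continuity. *)
Lemma is_RInt_Cderive (f df : R -> C) (a b : R) :
  (forall x, is_Cderive f x (df x)) ->
  (forall x, exists l, is_Cderive df x l) ->
  is_RInt (V := C_R_NormedModule) df a b (f b - f a).
Proof.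
intros Hf Hdf.
apply (is_RInt_fct_extend_pair (U := R_NormedModule) (V := R_NormedModule) df a b
  (fst (f b - f a)) (snd (f b - f a))).
- apply (is_RInt_derive (V := R_CompleteNormedModule) (fun t => fst (f t))).
  + intros x _; apply Hf.
  + intros x _; apply (ex_derive_continuous (fun t => fst (df t)) x).
    destruct (Hdf x) as [l [H _]]; now exists (fst l).
- apply (is_RInt_derive (V := R_CompleteNormedModule) (fun t => snd (f t))).
  + intros x _; apply Hf.
  + intros x _; apply (ex_derive_continuous (fun t => snd (df t)) x).
    destruct (Hdf x) as [l [_ H]]; now exists (snd l).
Qed.

Lemma is_RInt_gen_Cderive (f df : R -> C) (a : R) (l : C) :
  (forall x, is_Cderive f x (df x)) ->
  (forall x, exists l', is_Cderive df x l') ->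
  filterlim f (Rbar_locally p_infty) (locally l) ->
  is_RInt_gen (V := C_R_NormedModule) df (at_point a) (Rbar_locally p_infty) (l - f a).
Proof.
intros Hf Hdf Hl P HP.
assert (H : filterlim (fun b => f b + - f a) (Rbar_locally p_infty) (locally (l + - f a))).
{ apply filterlim_Cplus; [exact Hl | apply filterlim_const]. }
apply (Filter_prod _ _ _ (fun x => x = a) (fun b => P (f b - f a))).
- easy.
- exact (H P HP).
- intros x b -> Hb; exists (f b - f a); split; [|exact Hb].
  now apply is_RInt_Cderive.
Qed.

(** The exponential generating function of [c]: differentiation in [x] merely shifts the
    coefficients. *)
Definition Cegf (c : nat -> C) (x : R) : C :=
  CSeries (fun k => c k * RtoC (x ^ k / INR (fact k))).

Lemma is_series_exp (y : R) : is_series (fun k => y ^ k / INR (fact k))%R (exp y).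
Proof.
apply is_series_ext with (fun k => / INR (fact k) * y ^ k)%R.
- intros k; unfold Rdiv; apply Rmult_comm.
- apply is_pseries_R, is_exp_Reals.
Qed.

Lemma Cegf_term_le (c : nat -> C) (M r x : R) (k : nat) :
  (forall k, Cmod (c k) <= M * r ^ k)%R ->
  (Cmod (c k * RtoC (x ^ k / INR (fact k))) <=
   M * ((r * Rabs x) ^ k / INR (fact k)))%R.
Proof.
intros Hc; assert (Hk := INR_fact_lt_0 k); assert (Hi := Rinv_0_lt_compat _ Hk).
rewrite Cmod_mult, Cmod_R; unfold Rdiv.
rewrite Rabs_mult, (Rabs_pos_eq (/ _)), <- RPow_abs, Rpow_mult_distr by lra.
replace (M * (r ^ k * Rabs x ^ k * / INR (fact k)))%R
  with (M * r ^ k * (Rabs x ^ k * / INR (fact k)))%R by ring.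
apply Rmult_le_compat_r; [|apply Hc].
apply Rmult_le_pos; [apply pow_le, Rabs_pos | lra].
Qed.

Lemma is_series_Cegf_bound (M r x : R) :
  is_series (fun k => M * ((r * Rabs x) ^ k / INR (fact k)))%R (M * exp (r * Rabs x))%R.
Proof. apply (is_series_scal_l (V := R_NormedModule)), is_series_exp. Qed.

Lemma ex_series_Cegf (c : nat -> C) (M r x : R) :
  (forall k, Cmod (c k) <= M * r ^ k)%R ->
  ex_series (fun k => c k * RtoC (x ^ k / INR (fact k))).
Proof.
intros Hc; eapply ex_series_Cmod_le; [intros k; now apply (Cegf_term_le c M r)|].
eexists; apply is_series_Cegf_bound.
Qed.

Lemma Cmod_Cegf_le (c : nat -> C) (M r x : R) :
  (forall k, Cmod (c k) <= M * r ^ k)%R ->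
  (Cmod (Cegf c x) <= M * exp (r * Rabs x))%R.
Proof.
intros Hc; rewrite <- (is_series_unique _ _ (is_series_Cegf_bound M r x)).
apply Cmod_CSeries_le; [intros k; now apply Cegf_term_le|].
eexists; apply is_series_Cegf_bound.
Qed.

(** At the radius [|x| + 1], chosen to make the inequality strict, the terms are bounded by
    [M exp (r (|x| + 1))]. *)
Lemma CV_radius_egf (u : nat -> R) (M r x : R) :
  (0 <= M)%R -> (0 <= r)%R ->
  (forall k, Rabs (u k) <= M * r ^ k)%R ->
  Rbar_lt (Rabs x) (CV_radius (fun k => u k / INR (fact k))%R).
Proof.
intros HM Hr Hu; assert (Hx := Rabs_pos x).
apply Rbar_lt_le_trans with (Rabs x + 1)%R; [simpl; lra|].
apply (proj1 (CV_radius_bounded (fun k => u k / INR (fact k))%R)).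
exists (M * exp (r * (Rabs x + 1)))%R; intros k.
assert (Hk := INR_fact_lt_0 k); assert (Hi := Rinv_0_lt_compat _ Hk).
assert (Hy : (0 <= r * (Rabs x + 1))%R) by (apply Rmult_le_pos; lra).
assert (Hyk : forall j, (0 <= (r * (Rabs x + 1)) ^ j / INR (fact j))%R).
{ intros j; apply Rdiv_le_0_compat; [now apply pow_le | apply INR_fact_lt_0]. }
apply Rle_trans with (M * ((r * (Rabs x + 1)) ^ k / INR (fact k)))%R.
- unfold Rdiv; rewrite !Rabs_mult, (Rabs_pos_eq (/ _)), (Rabs_pos_eq (_ ^ _)) by
    (try apply pow_le; lra).
  rewrite Rpow_mult_distr.
  replace (M * (r ^ k * (Rabs x + 1) ^ k * / INR (fact k)))%R
    with (M * r ^ k * / INR (fact k) * (Rabs x + 1) ^ k)%R by ring.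
  apply Rmult_le_compat_r; [apply pow_le; lra|].
  apply Rmult_le_compat_r; [lra | apply Hu].
- apply Rmult_le_compat_l; [exact HM|].
  (* A single term is at most the partial sum of the nonnegative exponential series, hence at most
     its sum. *)
  eapply Rle_trans; [|apply (exp_ge_taylor _ k Hy)].
  destruct k as [|k]; [simpl; lra|].
  rewrite tech5; assert (H := cond_pos_sum _ k Hyk); lra.
Qed.

Lemma Cegf_PSeries (c : nat -> C) (x : R) :
  Cegf c x = (PSeries (fun k => fst (c k) / INR (fact k))%R x,
              PSeries (fun k => snd (c k) / INR (fact k))%R x).
Proof.
unfold Cegf, CSeries, PSeries; f_equal; apply Series_ext; intros k; simpl;
  unfold Rdiv; ring.
Qed.

Lemma Cegf_0 (c : nat -> C) : Cegf c 0 = c O.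
Proof.
rewrite Cegf_PSeries, !PSeries_0; simpl.
unfold Rdiv; rewrite Rinv_1, !Rmult_1_r; now destruct (c O).
Qed.

Lemma PS_derive_egf (u : nat -> R) (k : nat) :
  PS_derive (fun k => u k / INR (fact k))%R k = (u (S k) / INR (fact k))%R.
Proof.
unfold PS_derive; rewrite fact_simpl, mult_INR.
field; split; [apply INR_fact_neq_0 | apply not_0_INR; lia].
Qed.

Lemma is_Cderive_Cegf (c : nat -> C) (M r x : R) :
  (0 <= M)%R -> (0 <= r)%R -> (forall k, Cmod (c k) <= M * r ^ k)%R ->
  is_Cderive (Cegf c) x (Cegf (fun k => c (S k)) x).
Proof.
intros HM Hr Hc.
assert (D : forall u : nat -> R, (forall k, Rabs (u k) <= M * r ^ k)%R ->
  is_derive (PSeries (fun k => u k / INR (fact k))%R) x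
            (PSeries (fun k => u (S k) / INR (fact k))%R x)).
{ intros u Hu.
  rewrite <- (PSeries_ext _ _ x (PS_derive_egf u)).
  apply is_derive_PSeries; now apply (CV_radius_egf u M r). }
rewrite Cegf_PSeries; split; cbn [fst snd].
- apply is_derive_ext with (PSeries (fun k => fst (c k) / INR (fact k))%R).
  + intros t; now rewrite Cegf_PSeries.
  + apply (D (fun k => fst (c k))); intros k.
    eapply Rle_trans; [apply Rabs_fst_le_Cmod | apply Hc].
- apply is_derive_ext with (PSeries (fun k => snd (c k) / INR (fact k))%R).
  + intros t; now rewrite Cegf_PSeries.
  + apply (D (fun k => snd (c k))); intros k.
    eapply Rle_trans; [apply Rabs_snd_le_Cmod | apply Hc].
Qed.

Lemma filterlim_C_0 {T : Type} {F : (T -> Prop) -> Prop} {FF : Filter F} (f : T -> C) :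
  filterlim (fun x => Cmod (f x)) F (locally 0%R) -> filterlim f F (locally (RtoC 0)).
Proof.
intros H; assert (H' := proj1 (filterlim_locally _ _) H).
apply filterlim_locally; intros eps.
apply (filter_imp (fun x => ball 0%R eps (Cmod (f x)))); [|apply H'].
intros x Hx.
assert (Hx' : (Cmod (f x) < eps)%R).
{ change (Rabs (Cmod (f x) - 0) < eps)%R in Hx.
  rewrite Rminus_0_r in Hx; eapply Rle_lt_trans; [apply Rle_abs | exact Hx]. }
split.
- change (Rabs (fst (f x) - 0) < eps)%R; rewrite Rminus_0_r.
  eapply Rle_lt_trans; [apply Rabs_fst_le_Cmod | exact Hx'].
- change (Rabs (snd (f x) - 0) < eps)%R; rewrite Rminus_0_r.
  eapply Rle_lt_trans; [apply Rabs_snd_le_Cmod | exact Hx'].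
Qed.

Lemma is_lim_exp_neg (M d : R) :
  (0 < d)%R -> is_lim (fun x => M * exp (- (d * x)))%R p_infty 0%R.
Proof.
intros Hd.
replace (Finite 0) with (Rbar_mult M 0%R) by (simpl; f_equal; ring).
apply is_lim_scal_l.
apply is_lim_comp with m_infty; [apply is_lim_exp_m| |now exists 0%R].
replace m_infty with (Rbar_opp p_infty) by easy; apply is_lim_opp.
replace p_infty with (Rbar_mult d p_infty) at 2.
- apply is_lim_scal_l, is_lim_id.
- simpl; destruct (Rle_dec 0 d) as [H|H]; [|lra].
  destruct (Rle_lt_or_eq_dec 0 d H); [easy | lra].
Qed.

(* The antiderivative is [- exp (- s x) * Cegf h x], where [h] solves
   [s * h k - h (k + 1) = g k]; it vanishes at infinity because [h] grows no
   faster than [r ^ k] with [r < Re s]. *)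
Lemma is_RInt_gen_Laplace_Cegf (g : nat -> C) (s : C) (M r : R) :
  (0 <= M)%R -> (0 <= r < fst s)%R -> (forall k, Cmod (g k) <= M * r ^ k)%R ->
  is_RInt_gen (V := C_R_NormedModule) (fun x => Cexp (- (s * x)) * Cegf g x)
    (at_point 0%R) (Rbar_locally p_infty) (CSeries (fun k => g k * (/ s) ^ S k)).
Proof.
intros HM [Hr Hrs] Hg.
assert (Hms : (r < Cmod s)%R).
{ assert (H := Rabs_fst_le_Cmod s); assert (H' := Rle_abs (fst s)); lra. }
assert (Hs : s <> 0) by (apply Cmod_gt_0; lra).
(* Iterating [h k = (g k + h (k + 1)) / s] gives [h k] as the sum over [i] of [u k i], dominated by
   a geometric series of ratio [q = r / |s| < 1]. *)
set (u := fun k i => g (k + i)%nat * (/ s) ^ S i).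
set (q := (r / Cmod s)%R).
assert (Hq : (0 <= q < 1)%R).
{ unfold q; split; [apply Rdiv_le_0_compat; lra|].
  apply Rmult_lt_reg_r with (Cmod s); [lra|]; unfold Rdiv.
  rewrite Rmult_assoc, Rinv_l by lra; lra. }
assert (His : (0 < / Cmod s)%R) by (apply Rinv_0_lt_compat; lra).
assert (Hu : forall k i, (Cmod (u k i) <= M * r ^ k * / Cmod s * q ^ i)%R).
{ intros k i; unfold u, q, Rdiv.
  rewrite Cmod_mult, Cmod_pow, Cmod_inv by exact Hs.
  replace (M * r ^ k * / Cmod s * (r * / Cmod s) ^ i)%R
    with (M * r ^ (k + i) * (/ Cmod s) ^ S i)%R
    by (rewrite pow_add, Rpow_mult_distr; simpl; ring).
  apply Rmult_le_compat_r; [apply pow_le; lra | apply Hg]. }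
assert (Hgeom : forall k, is_series (fun i => M * r ^ k * / Cmod s * q ^ i)%R
                            (M * r ^ k * / Cmod s * / (1 - q))%R).
{ intros k; apply (is_series_scal_l (V := R_NormedModule)), is_series_geom.
  rewrite Rabs_pos_eq; lra. }
assert (Hex : forall k, ex_series (u k)).
{ intros k; eapply ex_series_Cmod_le; [apply Hu | eexists; apply Hgeom]. }
set (h := fun k => CSeries (u k)).
set (M' := (M * / Cmod s * / (1 - q))%R).
assert (HM' : (0 <= M')%R).
{ unfold M'; repeat apply Rmult_le_pos; try lra.
  apply Rlt_le, Rinv_0_lt_compat; lra. }
assert (Hh : forall k, (Cmod (h k) <= M' * r ^ k)%R).
{ intros k; replace (M' * r ^ k)%R with (M * r ^ k * / Cmod s * / (1 - q))%R
    by (unfold M'; ring).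
  rewrite <- (is_series_unique _ _ (Hgeom k)).
  apply Cmod_CSeries_le; [apply Hu | eexists; apply Hgeom]. }
assert (Hrec : forall k, s * h k = g k + h (S k)).
{ intros k; unfold h; rewrite (CSeries_incr_1 (u k)) by apply Hex.
  assert (E : CSeries (fun i => u k (S i)) = / s * CSeries (u (S k))).
  { rewrite <- CSeries_scal_l by apply Hex; apply CSeries_ext; intros i; unfold u.
    replace (k + S i)%nat with (S k + i)%nat by lia; simpl; ring. }
  rewrite E; unfold u; rewrite Nat.add_0_r; simpl; field; exact Hs. }
assert (HhS : forall k, (Cmod (h (S k)) <= M' * r * r ^ k)%R).
{ intros k; rewrite Rmult_assoc; apply Hh. }
assert (HM'r : (0 <= M' * r)%R) by now apply Rmult_le_pos.
set (F := fun x : R => (- (1)) * (Cexp (- (s * x)) * Cegf h x)).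
(* The recursion becomes the differential equation [s H = G + H'] of the generating functions, which
   gives [F' = exp (- s x) G]. *)
assert (HegfE : forall x, s * Cegf h x = Cegf g x + Cegf (fun k => h (S k)) x).
{ intros x; unfold Cegf.
  rewrite <- CSeries_scal_l by now apply (ex_series_Cegf h M' r).
  rewrite <- CSeries_plus.
  - apply CSeries_ext; intros k; rewrite Cmult_assoc, Hrec; ring.
  - now apply (ex_series_Cegf g M r).
  - now apply (ex_series_Cegf (fun k => h (S k)) (M' * r) r). }
(* The claimed value is [h 0 = - F 0], the boundary term at 0; the one at infinity is 0. *)
replace (CSeries (fun k => g k * (/ s) ^ S k)) with (0 - F 0%R).
- apply is_RInt_gen_Cderive.
  + intros x.
    assert (D := is_Cderive_mult _ _ x _ _ (is_Cderive_const (- (1)) x)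
      (is_Cderive_mult _ _ x _ _ (is_Cderive_Cexp s x)
        (is_Cderive_Cegf h M' r x HM' Hr Hh))).
    match type of D with is_Cderive _ _ ?l =>
      replace (Cexp (- (s * x)) * Cegf g x) with l end; [exact D|].
    assert (E := HegfE x).
    replace (Cegf g x) with (s * Cegf h x - Cegf (fun k => h (S k)) x)
      by (rewrite E; ring).
    ring.
  + intros x; eexists; apply is_Cderive_mult; [apply is_Cderive_Cexp|].
    now apply (is_Cderive_Cegf g M r).
  + apply filterlim_C_0.
    apply (is_lim_le_le_loc (fun _ => 0%R) (fun x => M' * exp (- ((fst s - r) * x)))%R _ p_infty 0%R).
    * exists 0%R; intros x Hx; split; [apply Cmod_ge_0|].
      unfold F; rewrite !Cmod_mult, Cmod_opp, Cmod_1, Rmult_1_l, Cmod_Cexp.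
      replace (fst (- (s * x))) with (- (fst s * x))%R by (simpl; ring).
      replace (- ((fst s - r) * x))%R with (- (fst s * x) + r * Rabs x)%R
        by (rewrite Rabs_pos_eq by lra; ring).
      rewrite exp_plus.
      assert (B := Cmod_Cegf_le h M' r x Hh).
      assert (P := exp_pos (- (fst s * x))); nra.
    * apply is_lim_const.
    * apply is_lim_exp_neg; lra.
- unfold F.
  rewrite Cegf_0.
  replace (Cexp (- (s * RtoC 0))) with (RtoC 1).
  + unfold h, u; simpl; ring.
  + rewrite Cmult_0_r, <- RtoC_opp, Ropp_0, Cexp_RtoC, exp_0; reflexivity.
Qed.

(** * The multi-index function with unit parameters *)

Lemma Cprod_mult (f g : nat -> C) (n : nat) :
  Cprod (fun i => f i * g i) n = Cprod f n * Cprod g n.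
Proof. induction n as [|n IH]; simpl; [|rewrite IH]; ring. Qed.

Lemma a_par_1 (nu : nat -> C) : a_par (fun _ => 1%R) nu 1 = 0.
Proof. unfold a_par; rewrite sum_n_n; simpl; ring. Qed.

(** The sum in [b_j] subtracts [alpha_0, ..., alpha_(j-1)], that in [a_j] subtracts
    [alpha_1, ..., alpha_j]; since [alpha_0 = 0], they differ by a single 1. *)
Lemma b_par_ones (nu : nat -> C) (j : nat) :
  (1 <= j)%nat -> b_par (fun _ => 1%R) nu j = a_par (fun _ => 1%R) nu j + 1.
Proof.
intros Hj; unfold a_par, b_par.
enough (E : sum_n_m (fun m => nu_ext nu (m - 1) - alpha_ext (fun _ => 1%R) (m - 1)) 1 j =
            sum_n_m (fun m => nu_ext nu (m - 1) - alpha_ext (fun _ => 1%R) m) 1 j + 1 :> C)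
  by (rewrite E; ring).
destruct j as [|j]; [lia | clear Hj].
induction j as [|j IH]; [rewrite !sum_n_n; simpl; ring|].
rewrite !(sum_n_Sm _ 1 (S j)), IH by lia.
change plus with Cplus; rewrite Nat.sub_succ, Nat.sub_0_r; simpl alpha_ext; ring.
Qed.

(** For each [j] the product over [i] telescopes to [Gamma (1 + c j) / Gamma (k + 1 + c j)];
    nonvanishing of [rGamma] allows the cancellations with its inverse [Gamma]. *)
Lemma Cprod_Gamma_ratio (c : nat -> C) (n k : nat) :
  (forall j i, (1 <= j <= n)%nat -> (1 <= i)%nat -> rGamma (INR i + c j) <> 0) ->
  Cprod (fun i => Cprod (fun j => Gamma (INR i + c j) * rGamma (INR i + (c j + 1))) n) k =
  Cprod (fun j => Gamma (1 + c j)) n * Cprod (fun j => rGamma (INR k + c j + 1)) n.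
Proof.
intros H; rewrite <- Cprod_mult; induction k as [|k IH].
- transitivity (Cprod (fun _ => 1) n).
  { clear; induction n as [|n IH]; [easy|]; simpl in *; rewrite <- IH; ring. }
  apply Cprod_ext; intros j Hj; unfold Gamma.
  change (INR 0) with 0%R; rewrite Cplus_0_l, (Cplus_comm (c j)).
  symmetry; apply Cinv_l, (H j 1%nat Hj); lia.
- change (Cprod ?f (S k)) with (Cprod f k * f (S k)); cbv beta.
  rewrite IH, <- Cprod_mult; apply Cprod_ext; intros j Hj.
  unfold Gamma; rewrite S_INR, RtoC_plus.
  replace (INR k + c j + 1) with (INR k + 1 + c j) by ring.
  replace (INR k + 1 + (c j + 1)) with (INR k + 1 + c j + 1) by ring.
  field; split.
  + apply (H j 1%nat Hj); lia.
  + rewrite <- RtoC_plus, <- S_INR; apply H; [easy | lia].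
Qed.

Lemma W_term_ones (n : nat) (nu : nat -> C) (z : C) (k : nat) :
  let a := a_par (fun _ => 1%R) nu in
  (forall j m : nat, (1 <= j <= n)%nat -> (1 <= m)%nat -> a j <> RtoC (- INR m)) ->
  W_term n (fun _ => 1%R) nu z k =
  Cprod (fun j => Gamma (1 + a j)) n *
  (Cprod (fun j => rGamma (INR k + a (j + 1)%nat + 1)) n * z ^ k) *
  RtoC (/ INR (fact k)).
Proof.
intros a Ha; unfold W_term.
rewrite (Cprod_ext _ (fun i => Cprod (fun j =>
  Gamma (INR i + a j) * rGamma (INR i + (a j + 1))) n)).
2: { intros i _; apply Cprod_ext; intros j Hj.
     rewrite b_par_ones by lia; now rewrite Cmult_1_l. }
rewrite Cprod_Gamma_ratio.
(* A pole [i + a j = - m] would mean [a j = - (i + m)], excluded because [i >= 1]; the value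
   [a j = 0] stays allowed. *)
2: { intros j i Hj Hi; apply rGamma_neq_0; intros m E.
     apply (Ha j (i + m)%nat Hj); [lia|].
     rewrite plus_INR, Ropp_plus_distr, RtoC_plus, <- E, RtoC_opp; ring. }
rewrite b_par_ones, Cmult_1_l by lia; fold a.
(* The factor with [b_(n+1) = a_(n+1) + 1] completes the product to [j = 1, ..., n+1]. Splitting off
   [j = 1] instead shifts the indices to [a_(j+1)] and leaves [1/k!], as [a_1 = 0]. *)
assert (E := Cprod_shift (fun j => rGamma (INR k + a j + 1)) n).
change (Cprod ?f (S n)) with (Cprod f n * f (S n)) in E; cbv beta in E.
replace (n + 1)%nat with (S n) by lia.
replace (INR k + a (S n) + 1) with (INR k + (a (S n) + 1)) in E by ring.
rewrite (Cprod_ext (fun j => rGamma (INR k + a (j + 1)%nat + 1))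
                   (fun i => rGamma (INR k + a (S i) + 1)))
  by (intros j _; now rewrite Nat.add_1_r).
unfold a in E at 3; rewrite a_par_1, Cplus_0_r, rGamma_INR_succ in E.
rewrite RtoC_inv by apply INR_fact_neq_0.
transitivity (Cprod (fun j => Gamma (1 + a j)) n * z ^ k *
  (Cprod (fun j => rGamma (INR k + a j + 1)) n * rGamma (INR k + (a (S n) + 1)))); [ring|].
rewrite E; ring.
Qed.

Lemma ML1_term_geometric_bound (n : nat) (mu : nat -> C) (z : C) (r : R) :
  (1 <= n)%nat -> (0 < r)%R ->
  exists M, (0 <= M)%R /\
    forall k, (Cmod (Cprod (fun j => rGamma (INR k + mu j)) n * z ^ k) <= M * r ^ k)%R.
Proof.
intros Hn Hr; assert (Hz := Cmod_ge_0 z).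
(* This rate of decay absorbs [z ^ k]; the added 1 keeps the quotient meaningful at [z = 0]. *)
assert (Hq : (0 < r / (Cmod z + 1))%R) by (apply Rdiv_lt_0_compat; lra).
destruct (Cprod_rGamma_geometric_decay n mu _ Hq Hn) as [M [HM H]].
exists M; split; [exact HM|]; intros k.
rewrite Cmod_mult, Cmod_pow.
eapply Rle_trans; [apply Rmult_le_compat_r; [now apply pow_le | apply H]|].
rewrite Rmult_assoc, <- Rpow_mult_distr.
apply Rmult_le_compat_l; [exact HM|]; apply pow_incr; split.
- apply Rmult_le_pos; lra.
- apply Rmult_le_reg_r with (Cmod z + 1)%R; [lra|].
  replace (r / (Cmod z + 1) * Cmod z * (Cmod z + 1))%R with (r * Cmod z)%R by (field; lra).
  nra.
Qed.

Theorem mainTheorem3 (n : nat) (lambda : R) (nu : nat -> C) (s : C) :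
  let alpha := fun _ : nat => 1%R in
  let a := a_par alpha nu in
  (1 <= n)%nat ->
  (forall j m : nat, (1 <= j <= n)%nat -> (1 <= m)%nat ->
     a j <> RtoC (- INR m)) ->
  (0 < fst s)%R ->
  let series_term := fun k : nat =>
    Cprod (fun j => rGamma (INR k + a (j + 1)%nat + 1)) n * (lambda / s) ^ k in
  (forall z : C, ex_series (W_term n alpha nu z)) /\
  ex_series series_term /\
  is_RInt_gen (V := C_R_NormedModule)
    (fun x : R => Cexp (- (s * x)) * W n alpha nu (lambda * x))
    (at_point 0%R) (Rbar_locally p_infty)
    (Cprod (fun j => Gamma (1 + a j)) n * (1 / s) * CSeries series_term) /\
  Cprod (fun j => Gamma (1 + a j)) n * (1 / s) * CSeries series_term =
  Cprod (fun j => Gamma (1 + a j)) n * (1 / s)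
    * ML1 n (fun j => a (j + 1)%nat + 1) (lambda / s).
Proof.
intros alpha a Hn Ha Hs series_term.
set (P := Cprod (fun j => Gamma (1 + a j)) n).
(* The coefficients for which [W (z x)] is [Cegf (g z) x]. *)
set (g := fun (z : C) (k : nat) =>
  P * (Cprod (fun j => rGamma (INR k + a (j + 1)%nat + 1)) n * z ^ k)).
assert (Hb : forall z r, (0 < r)%R -> exists M, (0 <= M)%R /\ forall k,
  (Cmod (Cprod (fun j => rGamma (INR k + a (j + 1)%nat + 1)) n * z ^ k) <= M * r ^ k)%R).
{ intros z r Hr.
  destruct (ML1_term_geometric_bound n (fun j => a (j + 1)%nat + 1) z r Hn Hr)
    as [M [HM H]].
  exists M; split; [exact HM|]; intros k; rewrite (Cprod_ext _
    (fun j => rGamma (INR k + (a (j + 1)%nat + 1)))); [apply H|].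
  intros j _; now rewrite Cplus_assoc. }
assert (Hg : forall z r, (0 < r)%R -> exists M, (0 <= M)%R /\
  forall k, (Cmod (g z k) <= M * r ^ k)%R).
{ intros z r Hr; destruct (Hb z r Hr) as [M [HM H]].
  exists (Cmod P * M)%R; split; [apply Rmult_le_pos; [apply Cmod_ge_0 | exact HM]|].
  intros k; unfold g; rewrite Cmod_mult, Rmult_assoc.
  apply Rmult_le_compat_l; [apply Cmod_ge_0 | apply H]. }
assert (HW : forall z (x : R) k, W_term n alpha nu (z * x) k =
  g z k * RtoC (x ^ k / INR (fact k))).
{ intros z x k; unfold alpha; rewrite W_term_ones by exact Ha; fold alpha a P.
  unfold g, Rdiv; rewrite Cpow_mult_l, RtoC_mult, RtoC_pow; ring. }
assert (Hex : ex_series series_term).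
{ destruct (Hb (lambda / s) (/ 2)%R ltac:(lra)) as [M [HM H]].
  apply (ex_series_Cmod_le _ _ H).
  apply (ex_series_scal_l (V := R_NormedModule)), ex_series_geom.
  rewrite Rabs_pos_eq; lra. }
assert (Hs0 : s <> 0) by (intros E; rewrite E in Hs; simpl in Hs; lra).
split; [|split; [exact Hex | split]].
(* The series of [W z] is the exponential series at [x = 1]. *)
- intros z; destruct (Hg z 1%R Rlt_0_1) as [M [HM H]].
  apply ex_series_ext with (fun k => g z k * RtoC (1 ^ k / INR (fact k))).
  + intros k; now rewrite <- HW, Cmult_1_r.
  + now apply (ex_series_Cegf (g z) M 1).
(* The coefficients decay faster than any geometric sequence, so a growth rate strictly below [Re s]
   is available for every [s] in the half-plane. *)
- assert (Hr : (0 < fst s / 2 < fst s)%R) by lra.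
  destruct (Hg lambda (fst s / 2)%R (proj1 Hr)) as [M [HM H]].
  assert (HI := is_RInt_gen_Laplace_Cegf (g lambda) s M (fst s / 2) HM
    (conj (Rlt_le _ _ (proj1 Hr)) (proj2 Hr)) H).
  replace (P * (1 / s) * CSeries series_term)
    with (CSeries (fun k => g lambda k * (/ s) ^ S k)).
  + revert HI; apply is_RInt_gen_ext, filter_forall; intros ab x _.
    f_equal; apply CSeries_ext; intros k; now rewrite HW.
  (* The extra power in [(/ s) ^ S k] is the prefactor [1 / s]. *)
  + rewrite <- CSeries_scal_l by exact Hex; apply CSeries_ext; intros k.
    unfold g, series_term, Cdiv; rewrite Cpow_mult_l; simpl; ring.
- f_equal; apply CSeries_ext; intros k; unfold series_term, ML1_term.
  rewrite Cmult_comm; f_equal; apply Cprod_ext; intros j _.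
  now rewrite Cplus_assoc.
Qed.
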